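(* If $A\le\mathcal{S}_m$ and $B\le\mathcal{S}_n$, then $\delta_1(A\wr_P B)=\mathcal{C}_B(\delta_1(A))$, where $\mathcal{C}_B(x)=\frac{1}{|B|}\sum_{\ell=1}^n\genfrac{[}{]}{0pt}{}{B}{\ell}x^\ell$.
   Context: $\mathcal{S}_n$ is the symmetric group on $[n]=\{1,\dots,n\}$; permutations act on the right, $x\mapsto xg$. For a finite group $G$ acting on a finite set, $\delta_1(G)$ is the proportion of elements of $G$ with exactly one fixed point; subgroups of $\mathcal{S}_n$ act naturally on $[n]$. $\genfrac{[}{]}{0pt}{}{B}{\ell}$ is the number of elements of $B$ with exactly $\ell$ cycles in their disjoint cycle decomposition (fixed points counted as cycles). The wreath product $A\wr B=A^{[n]}\rtimes B$ has underlying set $A^{[n]}\times B$ ($A^{[n]}$ being the group of functions $[n]\to A$ under pointwise multiplication) and multiplication $(\alpha,b)(\beta,c)=(\alpha\beta^{b^{-1}},bc)$, where $\beta^{b}(y)=\beta(yb^{-1})$. $A\wr_P B$ denotes $A\wr B$ acting on the set $[m]^{[n]}$ of functions $\omega\colon[n]\to[m]$ by $(\omega(\alpha,b))(y)=\omega(yb^{-1})\alpha(yb^{-1})$ (power action). *)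

(* Defs.v *)
From HB Require Import structures.
From mathcomp Require Import all_boot all_order all_algebra all_fingroup.

Set Implicit Arguments.
Unset Strict Implicit.
Unset Printing Implicit Defensive.

Import GRing.Theory.

(* The set [n] = {1, ..., n} is modelled by 'I_n.  The product of permutations
   in MathComp is (s * t) x = t (s x), so permutations act on the right: [x g]
   is written [g x], and [x g^-1] is written [g^-1 x]. *)

Section Proportion.

Variables (aT : finGroupType) (D : {set aT}) (rT : finType).
Local Open Scope group_scope.

Definition delta1 (to : action D rT) (G : {group aT}) : rat :=
  (#|[set g in G | #|'Fix_to[g]| == 1%N]|%:R / #|G|%:R)%R.

End Proportion.

Section CyclePolynomial.

Variable n : nat.

(* [porbits b] contains the singleton orbits, so fixed points count as cycles. *)
Definition num_cycles (B : {set 'S_n}) (l : nat) : nat :=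
  #|[set b in B | #|porbits b| == l]|.

Definition cycle_poly (B : {group 'S_n}) (x : rat) : rat :=
  (#|B|%:R^-1 * \sum_(1 <= l < n.+1) (num_cycles B l)%:R * x ^+ l)%R.

End CyclePolynomial.

Section Wreath.

Variables (gT : finGroupType) (n : nat).
Local Open Scope group_scope.

(* The function beta^b, i.e. beta^b (y) = beta (y b^-1). *)
Definition ffun_act (beta : {ffun 'I_n -> gT}) (b : 'S_n) : {ffun 'I_n -> gT} :=
  [ffun y => beta (b^-1 y)].

(* A record, not an alias of a product type: the latter already carries the
   direct product group structure. *)
Record wreath := Wreath { wr_base : {ffun 'I_n -> gT}; wr_top : 'S_n }.

Definition wreath_pair (w : wreath) := (wr_base w, wr_top w).
Definition pair_wreath p := Wreath p.1 p.2.
Lemma wreath_pairK : cancel wreath_pair pair_wreath.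
Proof. by case. Qed.

HB.instance Definition _ := Finite.copy wreath (can_type wreath_pairK).

Definition wr_one : wreath := Wreath 1 1.
Definition wr_mul (u v : wreath) : wreath :=
  Wreath (wr_base u * ffun_act (wr_base v) (wr_top u)^-1) (wr_top u * wr_top v).
Definition wr_inv (u : wreath) : wreath :=
  Wreath (ffun_act (wr_base u)^-1 (wr_top u)) (wr_top u)^-1.

Lemma wr_mulA : associative wr_mul.
Proof.
move=> [a s] [b t] [c u]; congr Wreath; rewrite /= ?mulgA //.
by apply/ffunP=> y; rewrite !ffunE !invgK permM mulgA.
Qed.

Lemma wr_mul1 : left_id wr_one wr_mul.
Proof.
move=> [a s]; congr Wreath; rewrite /= ?mul1g //.
by apply/ffunP=> y; rewrite !ffunE invgK perm1.
Qed.

Lemma wr_mulV : left_inverse wr_one wr_inv wr_mul.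
Proof.
move=> [a s]; congr Wreath; rewrite /= ?mulVg //.
by apply/ffunP=> y; rewrite !ffunE invgK mulVg.
Qed.

HB.instance Definition _ := Finite_isGroup.Build wreath wr_mulA wr_mul1 wr_mulV.

(* For A <= gT and B <= 'S_n, the group A wr B is the subgroup of gT wr 'S_n
   whose elements are the pairs (alpha, b) with alpha : [n] -> A and b in B. *)
Definition wreath_set (A : {set gT}) (B : {set 'S_n}) : {set wreath} :=
  [set w : wreath | [forall y, wr_base w y \in A] && (wr_top w \in B)].

Lemma wreath_group_set (A : {group gT}) (B : {group 'S_n}) :
  group_set (wreath_set A B).
Proof.
apply/group_setP; split=> [|u v].
  by rewrite inE group1 andbT; apply/forallP=> y; rewrite ffunE group1.
rewrite !inE => /andP[/forallP uA uB] /andP[/forallP vA vB].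
rewrite groupM // andbT; apply/forallP=> y.
by rewrite !ffunE groupM.
Qed.

Canonical wreath_group (A : {group gT}) (B : {group 'S_n}) : {group wreath} :=
  Group (wreath_group_set A B).

End Wreath.

Section PowerAction.

Variables m n : nat.
Local Open Scope group_scope.

Definition power_act (omega : {ffun 'I_n -> 'I_m}) (w : wreath 'S_m n) :
    {ffun 'I_n -> 'I_m} :=
  [ffun y => wr_base w ((wr_top w)^-1 y) (omega ((wr_top w)^-1 y))].

Lemma power_act1 omega : power_act omega 1 = omega.
Proof. by apply/ffunP=> y; rewrite !ffunE invg1 !perm1. Qed.

Lemma power_actM omega : act_morph power_act omega.
Proof.
move=> u v; apply/ffunP=> y.
by rewrite !ffunE /= invMg !permM invgK permKV.
Qed.

Definition power_action : {action wreath 'S_m n &-> {ffun 'I_n -> 'I_m}} :=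
  TotalAction power_act1 power_actM.

End PowerAction.

(* Main.v *)
(* Fix b in B. The number of fixed points of (alpha, b) on [m]^[n] is the
   product, over the cycles of b, of the number of fixed points in [m] of the
   product of alpha around the cycle; so it is 1 exactly when every cycle
   product has a single fixed point. Replacing the value of alpha at one
   representative of each cycle by the cycle product permutes A^[n], hence the
   cycle products are independent and uniform in A, and a proportion
   delta_1(A)^(number of cycles of b) of the alpha qualifies. *)
Require Import Defs.
From mathcomp Require Import all_boot all_order all_algebra all_fingroup.

Set Implicit Arguments.
Unset Strict Implicit.
Unset Printing Implicit Defensive.

Import GRing.Theory Num.Theory.

(** Every orbit contains exactly one root, so [froots b] is a set of representatives of the
    cycles. *)
Lemma card_porbits_roots (I : finType) (b : {perm I}) :
  #|porbits b| = #|froots b|.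
Proof.
have bC := fconnect_sym (@perm_inj _ b).
have rootE x : froot b x \in porbit b x.
  apply/porbitP; exists (findex b x (froot b x)).
  by rewrite permX iter_findex ?connect_root.
rewrite -[in RHS](@card_in_imset _ _ (porbit b)) => [|x y /eqP xr /eqP yr].
  apply: eq_card => P; apply/imsetP/imsetP => -[x _ ->]; last by exists x.
  exists (froot b x); first exact: roots_root.
  by apply/eqP; rewrite eq_porbit_mem porbit_sym.
move/eqP; rewrite eq_porbit_mem => /porbitP[i xE].
have: fconnect b y x by rewrite xE permX fconnect_iter.
by rewrite -(root_connect bC) xr yr => /eqP.
Qed.

(** * Products around the cycles as independent coordinates *)

Section CycleProducts.

Variables (gT : finGroupType) (I : finType) (b : {perm I}).
Implicit Types alpha : {ffun I -> gT}.
Local Open Scope group_scope.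

Let bC := fconnect_sym (@perm_inj _ b).

(** The factors follow the cycle from [y]; when they are permutations, acting on the right,
    [alpha y] is applied first. *)
Definition path_prod alpha y k := \prod_(i < k) alpha (iter i b y).

Definition cycle_prod alpha : {ffun I -> gT} :=
  [ffun y => if froots b y then path_prod alpha y (fingraph.order b y)
             else alpha y].

Lemma path_prodS alpha y k :
  path_prod alpha y k.+1 = path_prod alpha y k * alpha (iter k b y).
Proof. by rewrite /path_prod big_ord_recr. Qed.

Lemma notroot_iter y k : froots b y -> (0 < k < fingraph.order b y)%N ->
  froots b (iter k b y) = false.
Proof.
move=> /eqP yr /andP[k_gt0 k_lt]; apply/negbTE/negP => /eqP kr.
have := fconnect_iter b k y; rewrite -(root_connect bC) yr kr => /eqP yE.
by move: k_gt0; rewrite -(findex_iter k_lt) -yE findex0.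
Qed.

(** The later points of the cycle are not roots, so [cycle_prod] keeps their values; cancelling them
    recovers [alpha y]. *)
Lemma cycle_prod_root alpha y : froots b y ->
  cycle_prod alpha y =
  alpha y * \prod_(i < (fingraph.order b y).-1) cycle_prod alpha (iter i.+1 b y).
Proof.
move=> yr; rewrite ffunE yr /path_prod -(orderSpred b y) big_ord_recl /=.
congr (_ * _); apply: eq_bigr => i _; rewrite ffunE -iterS notroot_iter //=.
by rewrite -ltn_predRL ltn_ord.
Qed.

Lemma cycle_prod_inj : injective cycle_prod.
Proof.
move=> alpha beta eq_ab; apply/ffunP => y.
have : cycle_prod alpha y = cycle_prod beta y by rewrite eq_ab.
case yr: (froots b y); last by rewrite !ffunE yr.
by rewrite !cycle_prod_root // eq_ab => /mulIg.
Qed.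

(** Together with injectivity, this makes [cycle_prod] permute the functions with values in [A]. *)
Lemma cycle_prod_in (A : {group gT}) alpha :
  [forall y, cycle_prod alpha y \in A] = [forall y, alpha y \in A].
Proof.
apply/forallP/forallP => aA y; last first.
  by rewrite ffunE; case: ifP => // _; apply: group_prod.
have := aA y; case yr: (froots b y); last by rewrite ffunE yr.
by rewrite cycle_prod_root // groupMr //; apply: group_prod.
Qed.

(** The set is the preimage under the bijection [cycle_prod] of a product of sets: [P] constrains
    one coordinate per cycle, the others range over [A]. *)
Lemma card_cycle_prod (A : {group gT}) (P : pred gT) :
  (#|[set alpha : {ffun I -> gT} | [forall y, alpha y \in A] &
      [forall y, froots b y ==> P (cycle_prod alpha y)]]| =
   #|[set g in A | P g]| ^ #|porbits b| * #|A| ^ (#|I| - #|porbits b|))%N.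
Proof.
pose F y := if froots b y then [pred g | (g \in A) && P g] else mem A.
transitivity #|cycle_prod @^-1: [set beta | beta \in family F]|.
  apply: eq_card => alpha; rewrite !inE -(cycle_prod_in A).
  apply/andP/familyP => [[/forallP aA /forallP aP] y | aF].
    rewrite /F; move: (aA y) (aP y).
    by case: ifP => _ //= aAy aPy; rewrite inE aAy.
  split; apply/forallP => y; move: (aF y); rewrite /F.
    by case: ifP => // _ /andP[].
  by case: ifP => // _ /andP[].
rewrite card_preimset; last exact: cycle_prod_inj.
rewrite cardsE card_family foldrE big_image /= (bigID (froots b)) /=.
congr (_ * _)%N.
  rewrite card_porbits_roots -prod_nat_const; apply: eq_bigr => y yr.
  by rewrite /F yr cardsE.
rewrite card_porbits_roots.
have -> : (#|I| - #|froots b| = #|[predC froots b]|)%N.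
  by rewrite -(cardC (froots b)) addKn.
rewrite -prod_nat_const; apply: eq_bigr => y /negbTE yr.
by rewrite /F yr.
Qed.

End CycleProducts.

(** * Functions fixed by a single element *)

Section FixedPoints.

Variables (T I : finType) (b : {perm I}) (alpha : {ffun I -> {perm T}}).
Local Open Scope group_scope.

Let bC := fconnect_sym (@perm_inj _ b).

Let root_b y : froot b (b y) = froot b y.
Proof. by apply/eqP; rewrite (root_connect bC) bC fconnect1. Qed.

Let F (r : {r | froots b r}) := 'Fix_'P[cycle_prod b alpha (val r)].

Let rootS y : {r | froots b r} := exist _ (froot b y) (roots_root bC y).

(** Values chosen at the representatives are carried along each cycle by the partial products of
    [alpha]. *)
Let extend (v : {ffun {r | froots b r} -> T}) : {ffun I -> T} :=
  [ffun y => path_prod b alpha (froot b y) (findex b (froot b y) y)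
               (v (rootS y))].

Let rootS_val r : rootS (val r) = r.
Proof. by apply: val_inj; apply/eqP/(valP r). Qed.

Let extend_val v r : extend v (val r) = v r.
Proof.
have /eqP re := valP r; rewrite ffunE re findex0 rootS_val.
by rewrite /path_prod big_ord0 perm1.
Qed.

Let iter_fixed (omega : {ffun I -> T}) y k :
    (forall y, omega (b y) = alpha y (omega y)) ->
  omega (iter k b y) = path_prod b alpha y k (omega y).
Proof.
move=> fix_o; elim: k => [|k IHk]; first by rewrite /path_prod big_ord0 perm1.
by rewrite path_prodS permM -IHk -fix_o.
Qed.

(* A fixed function omega is determined by its values on representatives of the
   cycles of b, and the value at r can be any fixed point of the product of
   alpha around the cycle of r. *)
Lemma card_fixed_functions :
  #|[set omega : {ffun I -> T} | [forall y, omega (b y) == alpha y (omega y)]]|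
  = (\prod_(r | froots b r) #|'Fix_'P[cycle_prod b alpha r]|)%N.
Proof.
have -> : (\prod_(r | froots b r) #|'Fix_'P[cycle_prod b alpha r]| =
           \prod_r #|F r|)%N by rewrite [LHS]big_sub.
transitivity #|family F|; last by rewrite card_family foldrE big_image.
have extend_inj : injective extend.
  by move=> v w eq_vw; apply/ffunP => r; rewrite -!extend_val eq_vw.
rewrite -(card_imset _ extend_inj); apply: eq_card => omega; rewrite inE.
apply/forallP/imsetP => [fix_oP | [v /familyP vF ->{omega}] y].
  have fix_o y : omega (b y) = alpha y (omega y) by apply/eqP.
  exists [ffun r => omega (val r)].
    (* One full turn brings [omega] back to its value at [r], which is therefore fixed by the cycle
       product. *)
    apply/familyP => r; rewrite ffunE; apply/afix1P; rewrite /= apermE.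
    rewrite ffunE (valP r) -iter_fixed // iter_order //; exact: perm_inj.
  apply/ffunP => y; rewrite !ffunE /= -iter_fixed // iter_findex // bC.
  exact: connect_root.
have rC : fconnect b (froot b y) y by rewrite bC connect_root.
have rootSb : rootS (b y) = rootS y by apply: val_inj; rewrite /= root_b.
rewrite !ffunE rootSb root_b -permM.
set r := froot b y in rC *; set k := findex b r y.
have yE : iter k b r = y by apply: iter_findex.
rewrite -[in X in _ * alpha X]yE -path_prodS.
have byE : b y = iter k.+1 b r by rewrite iterS yE.
(* Either [b y] closes the cycle, and [v] picks a fixed point of the cycle product, or [b y] has
   index [k.+1] and both sides agree. *)
have := findex_max rC; rewrite -/k leq_eqVlt => /predU1P[k1E | k_lt]; last first.
  by rewrite byE findex_iter.
rewrite byE k1E iter_order; last exact: perm_inj.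
rewrite findex0 /path_prod big_ord0 perm1.
have /afix1P := vF (rootS y); rewrite /= apermE ffunE roots_root // => vE.
by apply/eqP; rewrite vE.
Qed.

End FixedPoints.

(** * Counting in the wreath product *)

Lemma prod_nat_eq1 (I : finType) (P : pred I) (F : I -> nat) :
  (\prod_(i | P i) F i == 1)%N = [forall i, P i ==> (F i == 1%N)].
Proof.
by rewrite (big_morph (fun k : nat => k == 1%N) muln_eq1 (eqxx _)) big_andE.
Qed.

(** Reading the fixed point equation at the image of [y] under [wr_top w] removes the inverse. *)
Lemma fix_power_action m n (w : wreath 'S_m n) :
  afix (power_action m n) [set w] =
  [set omega : {ffun 'I_n -> 'I_m} |
    [forall y, omega (wr_top w y) == wr_base w y (omega y)]].
Proof.
apply/setP => omega; rewrite inE; apply/afix1P/forallP => [fix_o y | fix_o].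
  by rewrite -[in X in X == _]fix_o ffunE permK.
apply/ffunP => y; rewrite ffunE; move/eqP: (fix_o ((wr_top w)^-1 y)%g) => <-.
by rewrite permKV.
Qed.

Lemma card_wreath (gT : finGroupType) n (A : {set gT}) (B : {set 'S_n}) :
  #|wreath_set A B| = (#|A| ^ n * #|B|)%N.
Proof.
rewrite -(card_imset _ (can_inj (@wreath_pairK gT n))).
rewrite -[n in (_ ^ n)%N]card_ord -card_ffun_on -(cardsE (ffun_on _)) -cardsX.
apply: eq_card => -[alpha b]; rewrite !inE /=.
apply/imsetP/andP => [[[a c]] | [/ffun_onP aA bB]].
  rewrite inE /= => /andP[/forallP aA cB] [-> ->]; split=> //.
  exact/ffun_onP.
by exists (Wreath alpha b) => //; rewrite inE /= bB andbT; apply/forallP.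
Qed.

(** Over each top component [b], a product over cycles equals 1 exactly when all its factors do, and
    [card_cycle_prod] counts these [alpha]. *)
Lemma card_wreath_fix1 m n (A : {group 'S_m}) (B : {group 'S_n}) :
  #|[set w in wreath_group A B | #|afix (power_action m n) [set w]| == 1%N]| =
  (\sum_(b in B) #|[set g in A | #|'Fix_'P[g]%g| == 1%N]| ^ #|porbits b|
                 * #|A| ^ (n - #|porbits b|))%N.
Proof.
rewrite -sum1_card (partition_big (@wr_top _ n) (mem B)) /=; last first.
  by move=> w; rewrite !inE => /andP[/andP[]].
apply: eq_bigr => b bB; rewrite sum1_card.
have := card_cycle_prod b A (fun g => #|'Fix_'P[g]%g| == 1%N).
rewrite card_ord => <-.
rewrite -(card_imset _ (f := fun alpha => Wreath alpha b)); last first.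
  by move=> ? ? [].
apply: eq_card => -[alpha c]; rewrite [LHS]inE !inE /= fix_power_action /=.
rewrite card_fixed_functions prod_nat_eq1.
apply/andP/imsetP => [[/andP[/andP[aA cB] aP] /eqP <-] | [beta]].
  by exists alpha => //; rewrite inE aA.
by rewrite inE => /andP[aA aP] [-> ->]; rewrite aA bB aP eqxx.
Qed.

Theorem corollary6p6 (m n : nat) (n_gt0 : (0 < n)%N)
    (A : {group 'S_m}) (B : {group 'S_n}) :
  delta1 (power_action m n) (wreath_group A B) = cycle_poly B (delta1 'P A).
Proof.
rewrite /delta1 card_wreath_fix1 card_wreath /cycle_poly.
set k := #|[set g in A | _]|.
(* As [n] is positive, every [b] has a cycle, so a sum starting at [l = 1] misses no element of
   [B]. *)
have cyc_gt0 (b : 'S_n) : (0 < #|porbits b|)%N.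
  by apply/card_gt0P; exists (porbit b (Ordinal n_gt0)); apply: imset_f.
have cyc_le (b : 'S_n) : (#|porbits b| <= n)%N.
  by rewrite -[leqRHS]card_ord; apply: leq_imset_card.
have A_neq0 : (#|A|%:R != 0 :> rat)%R by rewrite pnatr_eq0 -lt0n cardG_gt0.
have -> : (\sum_(1 <= l < n.+1) (num_cycles B l)%:R * (k%:R / #|A|%:R) ^+ l =
           \sum_(b in B) (k%:R / #|A|%:R) ^+ #|porbits b| :> rat)%R.
  (* After this shift, the index [l : 'I_n] stands for [l.+1] cycles, hence the predecessor
     below. *)
  rewrite big_add1 big_mkord /=.
  have cyc_lt (b : 'S_n) : (#|porbits b|.-1 < n)%N by rewrite prednK.
  rewrite (partition_big (fun b => Ordinal (cyc_lt b)) xpredT) //=.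
  apply: eq_bigr => l _; rewrite /num_cycles -sum1_card natr_sum mulr_suml.
  apply: eq_big => [b | b]; rewrite !inE.
    by rewrite -val_eqE /= -[in LHS](prednK (cyc_gt0 b)) eqSS.
  by move=> /andP[_ /eqP ->]; rewrite mul1r.
rewrite natrM natrX invfM mulrA mulrC natr_sum mulr_suml.
congr (_ * _)%R; apply: eq_bigr => b _.
(* The first factor cancels the free choices of [alpha] off the representatives. *)
have -> : (#|A|%:R ^+ n =
           #|A|%:R ^+ (n - #|porbits b|) * #|A|%:R ^+ #|porbits b| :> rat)%R.
  by rewrite -exprD subnK.
by rewrite natrM !natrX expr_div_n invfM mulrA mulfK ?expf_neq0.
Qed.
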